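(* Let $T$ be a finite tree graph with $L$ links and let $r\in\mathbb{R}$. Consider the system $\frac{dx_i}{dt}=\sum_{j\sim i}\left[r(x_i-x_j)-(x_i-x_j)^3\right]$ on $T$ with state space $X$, potential $V$, and critical potential $V_c=-(L-1)r^2/4$. Then the region $\{\mathbf{x}\in X: V(\mathbf{x})<V_c\}$ is partitioned by the basins of attraction of just the stable stationary states: $$\{\mathbf{x}\in X:V(\mathbf{x})<V_c\}=\bigcup_{\text{stable }\mathbf{x}^\star}\Big(W(\mathbf{x}^\star)\cap\{\mathbf{x}\in X:V(\mathbf{x})<V_c\}\Big),$$ where the union is disjoint. Furthermore, for each stable stationary state $\mathbf{x}^\star$, $$W(\mathbf{x}^\star)\cap\{\mathbf{x}\in X:V(\mathbf{x})<V_c\}=\Big\{\mathbf{x}\in X:\ (x_i-x_j)(x_i^\star-x_j^\star)>0\ \text{ for all } i\sim j,\ \text{ and } V(\mathbf{x})<V_c\Big\}.$$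
   Context: $i\sim j$ means that nodes $i$ and $j$ are linked. For a graph with $N$ nodes, the state space is $X=\mathbb{R}^N/\mathbf{1}$: two states are identified if they differ by a constant vector. $\mathbf{x}(t,\mathbf{x}_0)$ denotes the solution at time $t$ with initial condition $\mathbf{x}(0)=\mathbf{x}_0$. A stationary state is a state $\mathbf{x}^\star\in X$ at which all right-hand sides of the system vanish. The potential is $V(\mathbf{x})=\frac14\sum_{i\sim j}(x_i-x_j)^2\left((x_i-x_j)^2-2r\right)$, where the sum is over all links, each counted once; the system is $d\mathbf{x}/dt=-\nabla V(\mathbf{x})$. The basin of attraction of a stationary state is $W(\mathbf{x}^\star)=\{\mathbf{x}_0\in X:\lim_{t\to\infty}\mathbf{x}(t,\mathbf{x}_0)=\mathbf{x}^\star\}$. Stability is meant in the linear sense: a stationary state $\mathbf{x}^\star$ is stable if the (symmetric) Jacobian matrix $J(\mathbf{x}^\star)$ of the right-hand side at $\mathbf{x}^\star$, whose kernel always contains the constant vector, is negative definite on the orthogonal complement of the constant vector. *)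

(* Defs.v *)
From HB Require Import structures.
From mathcomp Require Import all_boot all_order all_algebra.
From mathcomp Require Import generic_quotient.
From mathcomp Require Import all_classical all_reals all_analysis.

Set Implicit Arguments.
Unset Strict Implicit.
Unset Printing Implicit Defensive.

Import Order.TTheory GRing.Theory Num.Theory.
Import numFieldNormedType.Exports.

Local Open Scope classical_set_scope.
Local Open Scope quotient_scope.
Local Open Scope ring_scope.

Definition simple_graph (N : nat) (e : rel 'I_N) : Prop :=
  symmetric e /\ irreflexive e.

(* [ucycle] also accepts the degenerate cycles [::] and, for each link i ~ j,
   [:: i; j]; a graph cycle is one with at least three nodes. *)
Definition acyclic (N : nat) (e : rel 'I_N) : Prop :=
  forall c : seq 'I_N, ucycle e c -> (size c <= 2)%N.

Definition tree (N : nat) (e : rel 'I_N) : Prop :=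
  [/\ (0 < N)%N, simple_graph e, forall i j, connect e i j & acyclic e].

(* Each link is represented once, by its increasing pair of end nodes. *)
Definition links (N : nat) (e : rel 'I_N) : {set 'I_N * 'I_N} :=
  [set p : 'I_N * 'I_N | (p.1 < p.2)%N && e p.1 p.2]%SET.

Section StateSpace.
Variables (R : realType) (N : nat).

Definition eq_mod_const : rel 'rV[R]_N :=
  fun x y => `[< exists c : R, y = x + const_mx c >].

Lemma eq_mod_const_refl : reflexive eq_mod_const.
Proof. by move=> x; apply/asboolP; exists 0; rewrite raddf0 addr0. Qed.

Lemma eq_mod_const_sym : symmetric eq_mod_const.
Proof.
move=> x y; apply/asboolP/asboolP => -[c ->]; exists (- c);
  by rewrite -addrA -raddfD/= subrr raddf0 addr0.
Qed.

Lemma eq_mod_const_trans : transitive eq_mod_const.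
Proof.
move=> y x z /asboolP[c ->] /asboolP[d ->]; apply/asboolP.
by exists (c + d); rewrite raddfD/= addrA.
Qed.

Canonical eq_mod_const_equiv := EquivRel eq_mod_const
  eq_mod_const_refl eq_mod_const_sym eq_mod_const_trans.

(* X = R^N / 1 with the quotient topology; states are row vectors, and
   functions of states that only involve differences x_i - x_j are evaluated
   on X through the canonical representative [repr]. *)
Definition state_space : Type := quotient_topology {eq_quot eq_mod_const}.
HB.instance Definition _ := Topological.copy state_space
  (quotient_topology {eq_quot eq_mod_const}).
HB.instance Definition _ := Quotient.copy state_space
  (quotient_topology {eq_quot eq_mod_const}).

Definition state_of (x : 'rV[R]_N) : state_space := \pi_(state_space) x.

Lemma repr_state_of_diff (x : 'rV[R]_N) (i j : 'I_N) :
  repr (state_of x) 0 i - repr (state_of x) 0 j = x 0 i - x 0 j.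
Proof.
have /eqmodP/asboolP[c ->] : x = repr (state_of x) %[mod {eq_quot eq_mod_const}].
  by have /= := reprK (state_of x).
by rewrite !mxE opprD addrACA subrr addr0.
Qed.

End StateSpace.

Section Dynamics.
Variables (R : realType) (N : nat) (e : rel 'I_N) (r : R).
Local Notation X := (state_space R N).

Definition vector_field (x : 'rV[R]_N) : 'rV[R]_N :=
  \row_i \sum_(j < N | e j i)
     (r * (x 0 i - x 0 j) - (x 0 i - x 0 j) ^+ 3).

Definition potential (x : 'rV[R]_N) : R :=
  4^-1 * \sum_(p in links e)
     (x 0 p.1 - x 0 p.2) ^+ 2 * ((x 0 p.1 - x 0 p.2) ^+ 2 - 2 * r).

Lemma vector_field_repr (x : 'rV[R]_N) :
  vector_field (repr (state_of x)) = vector_field x.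
Proof.
by apply/rowP => i; rewrite !mxE; apply: eq_bigr => j _;
  rewrite repr_state_of_diff.
Qed.

Lemma potential_repr (x : 'rV[R]_N) :
  potential (repr (state_of x)) = potential x.
Proof.
by rewrite /potential; congr (_ * _); apply: eq_bigr => p _;
  rewrite repr_state_of_diff.
Qed.

Definition critical_potential : R := - ((#|links e|%:R - 1) * r ^+ 2) / 4.

Definition subcritical : set X :=
  [set p | potential (repr p) < critical_potential].

(* Forward solutions only: for negative times solutions may blow up. *)
Definition solution (x : R -> 'rV[R]_N) : Prop :=
  {within `[0, +oo[, continuous x} /\
  forall t : R, 0 < t -> is_derive t (1 : R) x (vector_field (x t)).

(* The vector field is locally Lipschitz, so the solution issued from a given
   initial condition is unique. *)
Definition basin (q : X) : set X :=
  [set p | exists x : R -> 'rV[R]_N,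
     [/\ solution x, state_of (x 0) = p &
         state_of (x t) @[t --> +oo] --> q]].

Definition stationary (q : X) : Prop := vector_field (repr q) = 0.

Definition negative_definite_off_constants (J : 'M[R]_N) : Prop :=
  forall v : 'rV[R]_N, v != 0 -> v *m (const_mx 1 : 'rV[R]_N)^T = 0 ->
    (v *m J *m v^T) 0 0 < 0.

Definition stable : set X :=
  [set q | stationary q /\
           negative_definite_off_constants (jacobian vector_field (repr q))].

End Dynamics.

(* Main.v *)
Require Import Defs.
From HB Require Import structures.
From mathcomp Require Import all_boot all_order all_algebra.
From mathcomp Require Import generic_quotient.
From mathcomp Require Import all_classical all_reals all_analysis.
From mathcomp Require Import ring lra.

Set Implicit Arguments.
Unset Strict Implicit.
Unset Printing Implicit Defensive.

Import Order.TTheory GRing.Theory Num.Theory.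
Import numFieldNormedType.Exports.

Local Open Scope classical_set_scope.
Local Open Scope quotient_scope.
Local Open Scope ring_scope.

(** Write [d_e] for the difference of the state across a link [e].  The energy of
    one link is at least [-r^2/4], so each of the [L] links carries at most the
    gap [V(x) - V_c] ([edge_energy_le_gap]).  Below the critical potential this
    gap is negative, whereas [d_e = 0] would give energy [0]: no link difference
    vanishes, and the mere presence of a link forces [0 < r].  As [V] decreases
    along solutions, the region is forward invariant and every sign pattern of
    link differences is preserved ([solution_preserves_signs]).

    On a tree the link differences can be prescribed freely ([tree_potential]).
    Used as test vectors, such states decouple the links: a state is
    stationary iff every link force vanishes, and when [0 < r] it is stable iff
    [d_e^2 = r] on every link ([stationary_edge_force], [stable_edge_slope],
    [stable_of_edge_sqr]).  Stable states thus correspond to sign patterns.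

    It remains to see that a subcritical state converges to the stable state with
    its own signs.  The squared distance to that state decays exponentially: the
    link force contracts the distance on each link, uniformly because the
    differences stay away from [0], and the Poincare inequality of the graph turns
    this into decay of the whole distance ([solution_converges]).  The
    sign description of the basins, together with the fact that the signs
    determine a stable state, also makes them disjoint; in this way the argument
    never compares two solutions with the same initial condition.

    Solutions exist for all times because the force can be replaced outside the
    interval where the link energy is negative by a globally Lipschitz one
    ([trunc_force]) deriving from an energy that still confines the solution to
    that interval ([subcritical_solution_exists]); for Lipschitz fields
    the Picard iterates converge globally ([lipschitz_global_solution]). *)

(** * Trees as graphs on which differences along links are free *)

Definition edge_subgraph (N : nat) (e : rel 'I_N) (S : {set 'I_N}) : rel 'I_N :=
  fun i j => [&& e i j, i \in S & j \in S].

(** Two neighbours of [v] in a connected set [S] avoiding [v] would close a cycle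
    through [v]. *)
Lemma tree_unique_neighbor (N : nat) (e : rel 'I_N) (S : {set 'I_N})
    (u v w : 'I_N) :
  simple_graph e -> acyclic e -> v \notin S -> u \in S -> w \in S ->
  connect (edge_subgraph e S) w u -> e v w -> e v u -> w = u.
Proof.
move=> [esym _] eac vS uS wS /connectP[p pp ul] evw evu.
case/shortenP: pp ul => p' pp' up' _ ul.
apply/eqP/negPn/negP => wu.
have p'S : {subset w :: p' <= S}.
  elim: p' w pp' wS {up' ul evw wu} => [|a p' IH] w /=.
    by move=> _ wS z; rewrite inE => /eqP->.
  case/andP=> /and3P[_ _ aS] pa wS z; rewrite inE => /predU1P[->//|].
  exact: IH.
have : ucycle e [:: v, w & p'].
  apply/andP; split; last first.
    by rewrite /= -/(uniq (w :: p')) up' andbT; apply: contra vS => /p'S.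
  rewrite /= evw/= rcons_path -ul esym evu andbT.
  by apply: sub_path pp' => a b /and3P[].
move/eac; case: p' ul {pp' up' p'S} => //= ul.
by rewrite ul eqxx in wu.
Qed.

(** The state is built by growing a connected set of nodes one node at a time:
    a new node has a single link to the set, so its value is determined by that
    link and no compatibility condition arises. *)
Lemma tree_potential (N : nat) (e : rel 'I_N) (R : realType)
    (s : 'I_N -> 'I_N -> R) :
  tree e -> (forall i j, s j i = - s i j) ->
  exists x : 'rV[R]_N, forall i j, e i j -> x 0 i - x 0 j = s i j.
Proof.
move=> [N0 sg econ eac] sN; have [esym eirr] := sg.
pose good (S : {set 'I_N}) := [/\ Ordinal N0 \in S,
  forall i j, i \in S -> j \in S -> connect (edge_subgraph e S) i j &
  exists x : 'rV[R]_N, forall i j, i \in S -> j \in S -> e i j ->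
    x 0 i - x 0 j = s i j].
suff [S [_ _ [x xs]] ST] : exists2 S, good S & ~: S = finset.set0.
  by exists x => i j; apply: xs; rewrite -[S]finset.setCK ST finset.setC0 inE.
have : good [set Ordinal N0]%SET.
  split; rewrite ?inE//.
    by move=> i j; rewrite !inE => /eqP-> /eqP->; exact: connect0.
  by exists 0 => i j; rewrite !inE => /eqP-> /eqP->; rewrite eirr.
move: [set Ordinal N0]%SET => S; have [n] := ubnP #|~: S|.
elim: n S => // n IH S; rewrite ltnS => nS gS.
have [ST|/set0Pn[v0]] := eqVneq (~: S) finset.set0; first by exists S.
rewrite inE => v0S.
have [u [v [uS vS euv]]] : exists u v, [/\ u \in S, v \notin S & e u v].
  have [rS _ _] := gS.
  case/connectP: (econ (Ordinal N0) v0) => p.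
  elim: p (Ordinal N0) rS => [|a p IHp] b bS /=.
    by move=> _ E; rewrite E bS in v0S.
  case/andP=> eba pa; have [aS|aS] := boolP (a \in S); first exact: IHp.
  by move=> _; exists b, a.
apply: (IH (v |: S)).
  apply: leq_trans nS; apply: proper_card; rewrite properE; apply/andP; split.
    by rewrite finset.setCS finset.subsetUr.
  by apply/subsetPn; exists v; rewrite !inE ?eqxx.
have [rS cS [x xs]] := gS.
have sub i j : connect (edge_subgraph e S) i j ->
    connect (edge_subgraph e (v |: S)) i j.
  apply: connect_sub => a b /and3P[ab aS bS]; apply: connect1.
  by rewrite /edge_subgraph ab !inE aS bS !orbT.
have uv : connect (edge_subgraph e (v |: S)) u v.
  by apply: connect1; rewrite /edge_subgraph euv !inE uS eqxx orbT.
have vu : connect (edge_subgraph e (v |: S)) v u.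
  by apply: connect1; rewrite /edge_subgraph esym euv !inE uS eqxx orbT.
split; first by rewrite !inE rS orbT.
  move=> i j; rewrite !inE => /predU1P[->|iS] /predU1P[->|jS].
  - exact: connect0.
  - by apply: connect_trans vu _; apply: sub; exact: cS.
  - by apply: connect_trans uv; apply: sub; exact: cS.
  - by apply: sub; exact: cS.
have un w : w \in S -> e v w -> w = u.
  move=> wS evw; apply: (tree_unique_neighbor sg eac vS uS wS) => //.
    exact: cS.
  by rewrite esym.
exists (\row_k if k == v then x 0 u + s v u else x 0 k) => i j.
rewrite !inE !mxE.
have [-> _|iv /= iS] := eqVneq i v; have [-> _|jv /= jS] := eqVneq j v.
- by rewrite eirr.
- by move=> ej; rewrite (un _ jS ej) addrAC subrr add0r.
- by rewrite esym => ei; rewrite (un _ iS ei) opprD addrA subrr add0r -sN.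
- exact: xs.
Qed.

Section LinkSums.
Variables (R : realType) (N : nat) (e : rel 'I_N).
Hypothesis sg : simple_graph e.

(** Summation by parts: a link occurs twice in the sum over nodes, once from
    each end, with opposite signs. *)
Lemma sum_links_by_parts (u : 'rV[R]_N) (a : 'I_N -> 'I_N -> R) :
  (forall i j, a j i = - a i j) ->
  \sum_i u 0 i * (\sum_(j | e j i) a i j) =
  \sum_(p in links e) (u 0 p.1 - u 0 p.2) * a p.1 p.2.
Proof.
move=> aN; have [esym eirr] := sg.
under eq_bigr do rewrite mulr_sumr.
rewrite pair_big_dep/=.
rewrite (bigID (fun p : 'I_N * 'I_N => (p.1 < p.2)%N))/=.
under [RHS]eq_bigr do rewrite mulrBl.
rewrite [RHS]big_split/=; congr (_ + _).
  by apply: eq_bigl => -[i j]; rewrite inE/= esym andbC.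
rewrite (reindex_inj (h := fun p : 'I_N * 'I_N => (p.2, p.1)))/=; last first.
  by move=> [i j] [k l] [-> ->].
rewrite [RHS](eq_bigr (fun p => u 0 p.2 * a p.2 p.1)); last first.
  by move=> p _; rewrite (aN p.1 p.2) mulrN.
apply: eq_bigl => -[i j]; rewrite inE/= andbC -leqNgt leq_eqVlt.
by have [/val_inj->|] := eqVneq (i : nat) j; rewrite ?eirr ?andbF.
Qed.

(** Along a path, [(a - c)^2 <= 2 (a - b)^2 + 2 (b - c)^2] at each step; the
    constant grows with the length, but only its existence matters. *)
Lemma poincare_pair (i j : 'I_N) : connect e i j ->
  exists2 C : R, 0 <= C & forall z : 'rV[R]_N,
    (z 0 i - z 0 j) ^+ 2 <= C * \sum_(p in links e) (z 0 p.1 - z 0 p.2) ^+ 2.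
Proof.
have [esym eirr] := sg.
case/connectP => p; elim: p i => [|k p IH] i /=.
  by move=> _ ->; exists 0 => // z; rewrite subrr expr0n mul0r.
case/andP=> eik pp jl; have [C C0 HC] := IH _ pp jl.
(* The first link contributes [2], and the constant of the rest is doubled. *)
exists (2 + 2 * C); first by rewrite addr_ge0// mulr_ge0.
move=> z; set Q := \sum_(_ in _) _.
have ik : (z 0 i - z 0 k) ^+ 2 <= Q.
  have nn (P : pred ('I_N * 'I_N)) :
      0 <= \sum_(p in links e | P p) (z 0 p.1 - z 0 p.2) ^+ 2.
    by apply: sumr_ge0 => *; exact: sqr_ge0.
  have [ik|ki|/val_inj ik] := ltngtP i k; last by rewrite ik eirr in eik.
  - rewrite /Q (bigD1 (i, k)) ?inE/= ?ik//=.
    by rewrite lerDl nn.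
  - rewrite /Q (bigD1 (k, i)) ?inE/= ?ki ?(esym k i)//=.
    by rewrite -sqrrN opprB lerDl nn.
have := HC z; rewrite -/Q => kj.
have -> : (z 0 i - z 0 j) ^+ 2 = 2 * (z 0 i - z 0 k) ^+ 2 +
    2 * (z 0 k - z 0 j) ^+ 2 - (z 0 i - z 0 k - (z 0 k - z 0 j)) ^+ 2 by ring.
apply: (@le_trans _ _ (2 * Q + 2 * (C * Q))); last lra.
by rewrite lerBlDr ler_wpDr ?sqr_ge0// lerD// ler_wpM2l.
Qed.

(** For mean zero, the sum of squares is dominated by the sum of the squared
    differences over all pairs of nodes, to which [poincare_pair] applies. *)
Lemma poincare : (forall i j, connect e i j) ->
  exists2 C : R, 0 < C & forall z : 'rV[R]_N, \sum_i z 0 i = 0 ->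
    \sum_i z 0 i ^+ 2 <= C * \sum_(p in links e) (z 0 p.1 - z 0 p.2) ^+ 2.
Proof.
move=> con.
have /boolp.choice[C HC] : forall p : 'I_N * 'I_N, exists C : R, 0 <= C /\
  forall z : 'rV[R]_N, (z 0 p.1 - z 0 p.2) ^+ 2 <=
     C * \sum_(p in links e) (z 0 p.1 - z 0 p.2) ^+ 2.
  by move=> [i j]; have [C ? ?] := poincare_pair (con i j); exists C.
have S0 : 0 <= \sum_p C p by apply: sumr_ge0 => p _; have [] := HC p.
(* The added [1] only makes the constant positive. *)
exists (1 + \sum_p C p) => [|z z0]; first by rewrite ltr_pwDl.
set Q := \sum_(p in links e) _.
have Q0 : 0 <= Q by apply: sumr_ge0 => *; exact: sqr_ge0.
apply: (@le_trans _ _ (\sum_(p : 'I_N * 'I_N) (z 0 p.1 - z 0 p.2) ^+ 2)).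
  rewrite -(pair_big predT predT (fun i j => (z 0 i - z 0 j) ^+ 2))/=.
  apply: ler_sum => i _.
  have -> : \sum_j (z 0 i - z 0 j) ^+ 2 =
     z 0 i ^+ 2 *+ N + \sum_j z 0 j ^+ 2.
    rewrite (eq_bigr (fun j => (z 0 i ^+ 2 + z 0 j ^+ 2) + (- 2 * z 0 i) * z 0 j)).
      rewrite !big_split/= -[X in _ + X = _]mulr_sumr z0 mulr0 addr0.
      by rewrite sumr_const card_ord.
    by move=> j _; ring.
  apply: (@le_trans _ _ (z 0 i ^+ 2 *+ N)).
    by case: N i z {z0 Q Q0 HC S0} => [[]//|n] i z;
      rewrite mulrS lerDl mulrn_wge0// sqr_ge0.
  by rewrite lerDl sumr_ge0// => *; exact: sqr_ge0.
apply: (@le_trans _ _ ((\sum_p C p) * Q)).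
  by rewrite mulr_suml; apply: ler_sum => p _; have [_] := HC p; exact.
by rewrite ler_wpM2r// lerDr.
Qed.

End LinkSums.

(** * The energy and the force carried by a single link *)

Section EdgeFunctions.
Variables (R : realType) (r : R).
Implicit Types d x a b : R.

Definition edge_force d : R := r * d - d ^+ 3.
Definition edge_energy d : R := 4^-1 * (d ^+ 2 * (d ^+ 2 - 2 * r)).
(** The function [edge_force] where [d^2 <= 2 r], continued beyond by the linear
    force [- r * d], so that it is Lipschitz on the whole line. *)
Definition trunc_force d : R := - (d * Num.min (d ^+ 2 - r) r).
(** The primitive of [- trunc_force]: with [s = d^2 - 2 r], the link energy is
    [s^2 / 4 + r s / 2], and the truncation drops the square where [0 < s]. *)
Definition trunc_energy d : R :=
  4^-1 * Num.min (d ^+ 2 - 2 * r) 0 ^+ 2 + 2^-1 * (r * (d ^+ 2 - 2 * r)).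

Lemma edge_forceN d : edge_force (- d) = - edge_force d.
Proof. rewrite /edge_force; ring. Qed.

Lemma trunc_forceN d : trunc_force (- d) = - trunc_force d.
Proof. by rewrite /trunc_force sqrrN mulNr. Qed.

Lemma is_derive_edge_energy d : is_derive d 1 edge_energy (- edge_force d).
Proof.
rewrite /edge_energy /edge_force; apply: is_derive_eq.
rewrite /GRing.scale/=; lra.
Qed.

Lemma is_derive_sqr_neg_part x :
  is_derive x 1 (fun x : R => Num.min x 0 ^+ 2) (2 * Num.min x 0).
Proof.
have [x0|x0|->] := ltrgtP x 0.
-
  apply: (@near_eq_is_derive _ _ _ (fun x : R => x ^+ 2)).
    near=> z; congr (_ ^+ 2); apply/esym/min_idPl/ltW; near: z.
    exact: lt_nbhsl.
  by apply: is_derive_eq; rewrite /GRing.scale/=; ring.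
- rewrite mulr0.
  apply: (@near_eq_is_derive _ _ _ (cst 0)).
    near=> z; apply/esym/eqP; rewrite sqrf_eq0; apply/eqP/min_idPr/ltW; near: z.
    exact: lt_nbhsr.
- rewrite mulr0; apply/is_derive1_caratheodory.
  exists (fun z => Num.min z 0); split; rewrite ?minxx//.
    move=> z; rewrite expr0n/= !subr0.
    by have [_|_] := leP z 0; rewrite ?expr2 ?mul0r ?expr0n.
  apply: continuous_min; [exact: cvg_id|exact: cvg_cst].
Unshelve. all: by end_near. Qed.

Lemma is_derive_trunc_energy d : is_derive d 1 trunc_energy (- trunc_force d).
Proof.
have D1 : is_derive d 1 (fun d : R => d ^+ 2 - 2 * r) (2 * d).
  by apply: is_derive_eq; rewrite /GRing.scale/=; ring.
have D2 := @is_derive1_comp R (fun x : R => Num.min x 0 ^+ 2)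
  (fun d => d ^+ 2 - 2 * r) d _ _ (is_derive_sqr_neg_part _) D1.
rewrite /trunc_energy.
have := is_deriveD (is_deriveZ 4^-1 D2) (is_deriveZ 2^-1 (is_deriveZ r D1)).
move/(is_derive_eq); apply; rewrite /GRing.scale/= /trunc_force.
rewrite opprK (_ : Num.min (d ^+ 2 - r) r = Num.min (d ^+ 2 - 2 * r) 0 + r).
  by field.
by rewrite addr_minl add0r; congr (Num.min _ _); ring.
Qed.

(** The link energy is [((d^2 - r)^2 - r^2) / 4]. *)
Lemma edge_energy_ge d : - (r ^+ 2) / 4 <= edge_energy d.
Proof.
have -> : edge_energy d = - (r ^+ 2) / 4 + (d ^+ 2 - r) ^+ 2 / 4.
  by rewrite /edge_energy; field.
by rewrite lerDl divr_ge0// sqr_ge0.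
Qed.

Lemma trunc_energyE d : d ^+ 2 <= 2 * r -> trunc_energy d = edge_energy d.
Proof.
move=> dr; rewrite /trunc_energy (min_idPl _) ?subr_le0//.
by rewrite /edge_energy; field.
Qed.

Lemma trunc_forceE d : d ^+ 2 <= 2 * r -> trunc_force d = edge_force d.
Proof.
move=> dr; rewrite /trunc_force (min_idPl _); last by lra.
by rewrite /edge_force; ring.
Qed.

Lemma trunc_energy_le d : trunc_energy d <= edge_energy d.
Proof.
have [|dr] := leP (d ^+ 2) (2 * r); first by move/trunc_energyE->.
rewrite /trunc_energy (min_idPr _) ?subr_ge0 ?(ltW dr)//.
rewrite -subr_ge0.
suff -> : edge_energy d - (4^-1 * 0 ^+ 2 + 2^-1 * (r * (d ^+ 2 - 2 * r))) =
   ((d ^+ 2 - 2 * r) / 2) ^+ 2 by exact: sqr_ge0.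
by rewrite /edge_energy; field.
Qed.

Lemma trunc_energy_lt0 d : 0 <= r -> trunc_energy d < 0 -> d ^+ 2 <= 2 * r.
Proof.
move=> r0; apply: contraTT; rewrite -ltNge -leNgt => dr.
rewrite /trunc_energy (min_idPr _) ?subr_ge0 ?(ltW dr)//.
by rewrite expr0n/= mulr0 add0r !mulr_ge0// subr_ge0 ltW.
Qed.

Lemma trunc_energy_ge d : 0 <= r -> - (r ^+ 2) / 4 <= trunc_energy d.
Proof.
move=> r0; have [|dr] := leP (d ^+ 2) (2 * r).
  by move/trunc_energyE->; exact: edge_energy_ge.
apply: (@le_trans _ _ 0); first by rewrite mulNr oppr_le0 divr_ge0// sqr_ge0.
rewrite /trunc_energy (min_idPr _) ?subr_ge0 ?(ltW dr)//.
by rewrite expr0n/= mulr0 add0r !mulr_ge0// subr_ge0 ltW.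
Qed.

(** The constant is [7 |r|]: inside the interval [|d| <= sqrt (2 r)] the slopes
    are at most [7 r], and the mixed case compares both points with its endpoint. *)
Lemma trunc_force_lipschitz a b :
  `|trunc_force a - trunc_force b| <= 7 * `|r| * `|a - b|.
Proof.
have [r0|r0] := leP r 0.
  have E d : trunc_force d = - (d * r).
    by rewrite /trunc_force (min_idPr _)//; have := sqr_ge0 d; lra.
  rewrite !E -opprD normrN -mulrBl normrM.
  by have := mulr_ge0 (normr_ge0 r) (normr_ge0 (a - b)); lra.
wlog ab : a b / b ^+ 2 <= a ^+ 2.
  move=> H; have [/H//|/ltW/H] := leP (b ^+ 2) (a ^+ 2).
  by rewrite distrC (distrC b).
rewrite (gtr0_norm r0).
have [ar|ar] := leP (a ^+ 2) (2 * r).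
  rewrite !trunc_forceE//; last exact: le_trans ab ar.
  have -> : edge_force a - edge_force b =
      (r - (a ^+ 2 + a * b + b ^+ 2)) * (a - b) by rewrite /edge_force; ring.
  rewrite normrM ler_wpM2r// ler_norml; apply/andP; split; last first.
    by have := sqr_ge0 (a + b); have := sqr_ge0 a; have := sqr_ge0 b; lra.
  by have := sqr_ge0 (a - b); have := sqr_ge0 a; have := sqr_ge0 b; lra.
have Ea : trunc_force a = - (a * r).
  by rewrite /trunc_force (min_idPr _)//; lra.
have [br|br] := leP (b ^+ 2) (2 * r); last first.
  have Eb : trunc_force b = - (b * r).
    by rewrite /trunc_force (min_idPr _)//; lra.
  rewrite Ea Eb -opprD normrN -mulrBl normrM (gtr0_norm r0).
  by have := mulr_ge0 (ltW r0) (normr_ge0 (a - b)); lra.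
rewrite (trunc_forceE br) Ea.
have -> : - (a * r) - edge_force b = b * (b ^+ 2 - 2 * r) - r * (a - b).
  by rewrite /edge_force; ring.
apply: (le_trans (ler_normB _ _)).
rewrite [X in _ + X]normrM (gtr0_norm r0).
suff : `|b * (b ^+ 2 - 2 * r)| <= 4 * r * `|a - b|.
  by have := mulr_ge0 (ltW r0) (normr_ge0 (a - b)); lra.
set s := Num.sqrt (2 * r).
have s2 : s ^+ 2 = 2 * r by rewrite sqr_sqrtr// mulr_ge0// ltW.
have s0 : 0 <= s by exact: sqrtr_ge0.
have bs : `|b| <= s by rewrite -ler_sqr ?nnegrE// real_normK ?num_real// s2.
have sa : s <= `|a| by rewrite -ler_sqr ?nnegrE// real_normK ?num_real// s2 ltW.
have sb : s - `|b| <= `|a - b|.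
  by rewrite (le_trans _ (lerB_dist _ _))// lerD2r.
have -> : `|b * (b ^+ 2 - 2 * r)| = `|b| * (s + `|b|) * (s - `|b|).
  rewrite normrM -mulrA; congr (_ * _); rewrite ler0_norm ?subr_le0//.
  by rewrite -s2 -(real_normK (num_real b)); ring.
apply: ler_pM => //; rewrite ?subr_ge0// ?mulr_ge0 ?addr_ge0//.
have -> : 4 * r = s * (s + s) by rewrite mulrDr -expr2 s2; ring.
by apply: ler_pM => //; rewrite ?addr_ge0// lerD2l.
Qed.

End EdgeFunctions.

(** * Global solutions of Lipschitz differential equations *)

Section MatrixCalculus.
Variables (R : realType) (m n : nat).

Lemma mx_norm_ge_coord (A : 'M[R]_(m, n)) i j : `|A i j| <= `|A|.
Proof.
rewrite [leRHS]/Num.Def.normr/= mx_normrE.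
exact: (le_bigmax _ (fun ij : 'I_m * 'I_n => `|A ij.1 ij.2|) (i, j)).
Qed.

Lemma mx_norm_le (A : 'M[R]_(m, n)) c : 0 <= c ->
  (forall i j, `|A i j| <= c) -> `|A| <= c.
Proof.
move=> c0 Ac; rewrite [leLHS]/Num.Def.normr/= mx_normrE.
by apply: bigmax_le => // -[i j] _; exact: Ac.
Qed.

Lemma cvg_mx_coord (T : Type) (G : set_system T) (f : T -> 'M[R]_(m, n))
    (l : 'M[R]_(m, n)) : Filter G ->
  (forall i j, f x i j @[x --> G] --> l i j) -> f @ G --> l.
Proof.
move=> FG fl; apply/cvgrPdist_le => eps e0.
near=> x; apply: mx_norm_le; first exact: ltW.
move=> i j; rewrite !mxE; move: i j.
suff : forall ij : 'I_m * 'I_n, `|l ij.1 ij.2 - f x ij.1 ij.2| <= eps.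
  by move=> H i j; exact: (H (i, j)).
near: x; apply: filter_forall => -[i j].
by move: (fl i j) => /cvgrPdist_le /(_ _ e0).
Unshelve. all: by end_near. Qed.

Lemma is_derive_mxP (V : normedModType R) (f : V -> 'M[R]_(m, n)) x v df :
  is_derive x v f df <-> forall i j, is_derive x v (fun y => f y i j) (df i j).
Proof.
split=> [[fd <-] i j|fd].
  have fdij := (derivable_mxP f x v).1 fd i j.
  by apply: DeriveDef => //; rewrite derive_mx// mxE.
have dbl : derivable f x v by apply/derivable_mxP => i j; have [] := fd i j.
apply: DeriveDef => //; rewrite derive_mx//.
by apply/matrixP => i j; rewrite mxE; have [_] := fd i j.
Qed.

End MatrixCalculus.

Section Growth.
Variable R : realType.
Implicit Types (f df : R -> R) (a c t : R).

Lemma nonincreasing_of_derive f df :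
  {within `[0, +oo[, continuous f} ->
  (forall t, 0 < t -> is_derive t 1 f (df t)) ->
  (forall t, 0 < t -> df t <= 0) ->
  forall s t, 0 <= s -> s <= t -> f t <= f s.
Proof.
move=> fc fd d0; apply: ler0_derive1_nincry => // t.
  by rewrite in_itv/= andbT => t0; have [] := fd t t0.
rewrite in_itv/= andbT => t0; rewrite derive1E.
by have [_ ->] := fd t t0; exact: d0.
Qed.

Lemma is_derive_exp_scale c a t :
  is_derive t 1 (fun t : R => c * expR (a * t)) (a * (c * expR (a * t))).
Proof.
have D1 : is_derive t 1 (fun t : R => a * t) a.
  by apply: is_derive_eq; rewrite /GRing.scale/= mulr1.
have D2 := @is_derive1_comp R expR (fun t => a * t) t _ _ (is_derive_expR _) D1.
have := is_deriveZ c D2; move/is_derive_eq; apply.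
by rewrite /GRing.scale/=; ring.
Qed.

(** Bounds by [c * exp (a * t)] are stable under integration with a gain of a
    factor [a]; this is what makes the Picard map a contraction for
    exponentially weighted distances on the whole half-line. *)
Lemma exp_growth_bound f df a c :
  0 < a -> 0 <= c -> f 0 = 0 -> {within `[0, +oo[, continuous f} ->
  (forall t, 0 < t -> is_derive t 1 f (df t)) ->
  (forall t, 0 < t -> `|df t| <= a * (c * expR (a * t))) ->
  forall t, 0 <= t -> `|f t| <= c * expR (a * t).
Proof.
move=> a0 c0 f0 fc fd dfb t t0.
pose g := fun t : R => c * expR (a * t).
have gc : {within `[0, +oo[, continuous g}.
  apply: continuous_subspaceT => s; apply/differentiable_continuous.
  by apply/derivable1_diffP; have [] := is_derive_exp_scale c a s.
have H1 := @nonincreasing_of_derive (f - g) _ (within_continuousB fc gc)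
  (fun s s0 => is_deriveB (fd s s0) (is_derive_exp_scale c a s)).
have H2 := @nonincreasing_of_derive (- f - g) _
  (within_continuousB (fun s => continuousN (fc s)) gc)
  (fun s s0 => is_deriveB (is_deriveN (fd s s0)) (is_derive_exp_scale c a s)).
have g0 : 0 <= g 0 by rewrite mulr_ge0// expR_ge0.
have {}H1 : f t - g t <= f 0 - g 0.
  apply: H1 => // s s0; rewrite subr_le0.
  by apply: le_trans (dfb s s0); exact: ler_norm.
have {}H2 : - f t - g t <= - f 0 - g 0.
  apply: H2 => // s s0; rewrite subr_le0.
  by apply: le_trans (dfb s s0); rewrite ler_normr lexx orbT.
by rewrite -/(g t) ler_norml; apply/andP; split; lra.
Qed.

End Growth.

Section Primitive.
Variable R : realType.
Notation mu := (@lebesgue_measure R).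

(** The integral starts at [-1] rather than [0] so that the primitive is also
    differentiable at [0]. *)
Definition primitive (f : R -> R) (t : R) : R :=
  (\int[mu]_(s in [set` `[- 1, t]]) f s - \int[mu]_(s in [set` `[- 1, 0]]) f s)%R.

Lemma primitive0 f : primitive f 0 = 0.
Proof. by rewrite /primitive subrr. Qed.

Lemma is_derive_primitive (f : R -> R) (t : R) : continuous f -> - 1 < t ->
  is_derive t 1 (primitive f) (f t).
Proof.
move=> fc t1.
have [] := @continuous_FTC1_closed R f (-1) t (t + 1) _ _ t1 (fc t).
- by rewrite ltrDl.
- apply: continuous_compact_integrable; first exact: segment_compact.
  exact: continuous_subspaceT.
move=> Fd; rewrite derive1E => FE.
have := is_deriveB (DeriveDef Fd FE)
  (is_derive_cst (\int[mu]_(s in [set` `[- 1, 0]]) f s)%R t (1 : R)).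
by rewrite subr0.
Qed.

End Primitive.

(** The tail of the geometric series bounds the distance to the limit, at every
    rank; the Picard iteration uses this bound, locally uniform in time. *)
Lemma geometric_cauchy_cvg (R : realType) (p q : nat)
    (u : nat -> 'M[R]_(p, q)) (c : R) :
  (forall n, `|u n.+1 - u n| <= c * 2^-1 ^+ n) ->
  exists l, forall n, `|l - u n| <= 2 * c * 2^-1 ^+ n.
Proof.
move=> uc; pose h : R := 2^-1.
have c0 : 0 <= c by have := uc 0%N; rewrite expr0 mulr1; exact: le_trans.
have q0 n : 0 < h ^+ n by rewrite exprn_gt0// /h invr_gt0.
have dist n m : `|u (n + m)%N - u n| <= 2 * c * h ^+ n.
  have : `|u (n + m)%N - u n| <= 2 * c * h ^+ n * (1 - h ^+ m).
    elim: m => [|m IH]; first by rewrite addn0 subrr normr0 expr0 subrr mulr0.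
    rewrite addnS; apply: le_trans (ler_distD (u (n + m)%N) _ _) _.
    apply: le_trans (lerD (uc _) IH) _.
    rewrite -/h exprS; have -> : 1 - h * h ^+ m = (1 - h ^+ m) + h ^+ m / 2.
      by rewrite {1}/h; field.
    by rewrite exprD; lra.
  move/le_trans; apply; rewrite ler_piMr ?mulr_ge0 ?(ltW (q0 _))//.
  by rewrite gerBl ltW.
have q1 : `|h| < 1 by rewrite ger0_norm /h ?invr_ge0// invf_lt1// ltr1n.
have small e : 0 < e -> \forall n \near \oo, 2 * c * h ^+ n < e.
  move=> e0; have := @cvg_geometric R (2 * c) h q1.
  move=> /cvgrPdist_lt/(_ _ e0); apply: filterS => n /=.
  by rewrite sub0r normrN; apply: le_lt_trans; exact: ler_norm.
have cu : cvg (u @ \oo).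
  apply/cauchy_cvgP/cauchy_exP => e e0.
  have [n _ /(_ n (leqnn n)) ne] := small _ e0.
  exists (u n); exists n => // k /= nk; rewrite -ball_normE/= distrC.
  by rewrite -(subnKC nk); apply: le_lt_trans ne.
exists (lim (u @ \oo)) => n.
have cd : `|u k - u n| @[k --> \oo] --> `|lim (u @ \oo) - u n|.
  by apply: cvg_norm; apply: cvgB => //; exact: cvg_cst.
apply: (cvgr_to_le cd); exists n => // k /= nk.
by rewrite -(subnKC nk).
Qed.

Section Picard.
Variables (R : realType) (n : nat).
Notation V := 'rV[R]_n.
Variables (F : V -> V) (K : R).
Hypothesis K0 : 0 < K.
Hypothesis FK : forall x y, `|F x - F y| <= K * `|x - y|.
Variable x0 : V.

Lemma lipschitz_continuous : continuous F.
Proof.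
move=> x; apply/(@cvgrPdist_le _ _ _ _ (nbhs_filter x)) => e e0; apply/nbhs_ballP.
exists (K^-1 * e) => [|y]; first by rewrite /= mulr_gt0// invr_gt0.
rewrite -ball_normE/= => /ltW xy; apply: le_trans (FK _ _) _.
by rewrite -ler_pdivlMl.
Qed.

(** Time is clipped at [0], which keeps every iterate continuous on the whole
    line although only positive times are of interest. *)
Definition picard_map (u : R -> V) (t : R) : V :=
  \row_i (x0 0 i + primitive (fun s => F (u s) 0 i) (Num.max t 0)).

Let coordc (u : R -> V) i : continuous u -> continuous (fun s => F (u s) 0 i : R).
Proof.
move=> uc s; apply: (@continuous_comp _ _ _ (F \o u) (fun v : V => v 0 i)).
  by apply: continuous_comp; [exact: uc|exact: lipschitz_continuous].
exact: coord_continuous.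
Qed.

Let max0_gt (t : R) : -1 < Num.max t 0.
Proof. by rewrite lt_max ltrN10 orbT. Qed.

Let prim_cont (f : R -> R) : continuous f ->
  continuous (fun t : R => primitive f (Num.max t 0)).
Proof.
move=> fc t; apply: (@continuous_comp _ _ _ (fun t : R => Num.max t 0) (primitive f)).
  by apply: continuous_max; [exact: cvg_id|exact: cvg_cst].
apply/differentiable_continuous/derivable1_diffP.
by have [] := is_derive_primitive fc (max0_gt t).
Qed.

Let prim_derive (f : R -> R) (t : R) : continuous f -> 0 < t ->
  is_derive t 1 (fun t : R => primitive f (Num.max t 0)) (f t).
Proof.
move=> fc t0; apply: (@near_eq_is_derive _ _ _ (primitive f)).
  by near=> s; rewrite max_l//; apply/ltW; near: s; exact: lt_nbhsr.
by apply: is_derive_primitive => //; rewrite (lt_trans _ t0).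
Unshelve. all: by end_near. Qed.

Lemma picard_map_continuous (u : R -> V) : continuous u -> continuous (picard_map u).
Proof.
move=> uc t; apply: cvg_mx_coord => i j.
rewrite [X in _ --> X]mxE; under eq_fun do rewrite mxE.
by apply: cvgD; [exact: cvg_cst|exact/prim_cont/coordc].
Qed.

Lemma is_derive_picard_map (u : R -> V) (t : R) : continuous u -> 0 < t ->
  is_derive t 1 (picard_map u) (F (u t)).
Proof.
move=> uc t0; apply/is_derive_mxP => i j; rewrite ord1.
under eq_fun do rewrite mxE.
have := is_deriveD (is_derive_cst (x0 0 j) t 1) (prim_derive (@coordc u j uc) t0).
by rewrite add0r.
Qed.

Lemma picard_map0 (u : R -> V) : picard_map u 0 = x0.
Proof. by apply/rowP => i; rewrite mxE maxxx primitive0 addr0. Qed.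

(** The weight [exp (2 K t)] makes the factor [1/2]: the difference of the
    derivatives is at most [K c exp (2 K t)], whose integral is
    [(c / 2) exp (2 K t)] up to a constant. *)
Lemma picard_map_contract (u v : R -> V) (c : R) :
  0 <= c -> continuous u -> continuous v ->
  (forall t, 0 <= t -> `|u t - v t| <= c * expR (2 * K * t)) ->
  forall t, 0 <= t ->
    `|picard_map u t - picard_map v t| <= 2^-1 * c * expR (2 * K * t).
Proof.
move=> c0 uc vc uv t t0.
have c20 : 0 <= 2^-1 * c by rewrite mulr_ge0.
apply: mx_norm_le => [|k i]; first by rewrite mulr_ge0// expR_ge0.
rewrite ord1 mxE [in X in _ + X]mxE {k}.
apply: (@exp_growth_bound R (fun t => picard_map u t 0 i - picard_map v t 0 i)
   (fun t => F (u t) 0 i - F (v t) 0 i)) => //.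
- by rewrite mulr_gt0.
- by rewrite !picard_map0 subrr.
- apply: continuous_subspaceT => s; apply: cvgB.
    apply: (@continuous_comp _ _ _ (picard_map u) (fun v : V => v 0 i)).
      exact: picard_map_continuous.
    exact: coord_continuous.
  apply: (@continuous_comp _ _ _ (picard_map v) (fun v : V => v 0 i)).
    exact: picard_map_continuous.
  exact: coord_continuous.
- move=> s s0; apply: is_deriveB.
    exact: (is_derive_mxP _ _ _ _).1 (is_derive_picard_map uc s0) 0 i.
  exact: (is_derive_mxP _ _ _ _).1 (is_derive_picard_map vc s0) 0 i.
- move=> s s0.
  have -> : 2 * K * (2^-1 * c * expR (2 * K * s)) = K * (c * expR (2 * K * s)).
    by field.
  have := mx_norm_ge_coord (F (u s) - F (v s)) 0 i; rewrite !mxE.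
  move/le_trans; apply; apply: le_trans (FK _ _) _.
  by rewrite ler_wpM2l ?(ltW K0)// uv// ltW.
Qed.

(** The initial distance, in the weighted sense, that the contraction then halves
    at each step. *)
Lemma picard_map_dist0 (t : R) : 0 <= t ->
  `|picard_map (cst x0) t - x0| <= `|F x0| / (2 * K) * expR (2 * K * t).
Proof.
move=> t0.
have xc : continuous (cst x0 : R -> V) by move=> s; exact: cvg_cst.
have c0 : 0 <= `|F x0| / (2 * K) by rewrite divr_ge0// mulr_ge0// ltW.
apply: mx_norm_le => [|k i]; first by rewrite mulr_ge0// expR_ge0.
rewrite ord1 mxE [in X in _ + X]mxE {k}.
apply: (@exp_growth_bound R (fun t => picard_map (cst x0) t 0 i - x0 0 i)
   (fun t => F x0 0 i - 0)) => //.
- by rewrite mulr_gt0.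
- by rewrite !picard_map0 subrr.
- apply: continuous_subspaceT => s; apply: cvgB; last exact: cvg_cst.
  apply: (@continuous_comp _ _ _ (picard_map _) (fun v : V => v 0 i)).
    exact: picard_map_continuous.
  exact: coord_continuous.
- move=> s s0; apply: is_deriveB.
  exact: (is_derive_mxP _ _ _ _).1 (is_derive_picard_map xc s0) 0 i.
- move=> s s0; rewrite subr0.
  have -> : 2 * K * (`|F x0| / (2 * K) * expR (2 * K * s)) =
      `|F x0| * expR (2 * K * s) by field; rewrite gt_eqF.
  apply: le_trans (mx_norm_ge_coord _ _ _) _; rewrite ler_peMr//.
  by rewrite -expR0 ler_expR !mulr_ge0// ltW.
Qed.

(** The weighted distance of consecutive Picard iterates is halved at each step,
    so they converge locally uniformly to a fixed point of the Picard map. *)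
Lemma lipschitz_global_solution :
  exists x : R -> V, [/\ x 0 = x0, continuous x &
    forall t : R, 0 < t -> is_derive t 1 x (F (x t))].
Proof.
pose u k := iter k picard_map (cst x0).
pose c := `|F x0| / (2 * K).
have c0 : 0 <= c by rewrite divr_ge0// mulr_ge0// ltW.
have uc k : continuous (u k).
  elim: k => [|k IH]; first by move=> s; exact: cvg_cst.
  exact: picard_map_continuous.
have step k (t : R) : 0 <= t -> `|u k.+1 t - u k t| <= c * expR (2 * K * t) * 2^-1 ^+ k.
  move=> t0.
  have : `|u k.+1 t - u k t| <= c * 2^-1 ^+ k * expR (2 * K * t).
    elim: k t t0 => [|k IH] t t0.
      by rewrite expr0 mulr1; exact: picard_map_dist0.
    rewrite exprS mulrCA; apply: picard_map_contract => //.
      by rewrite mulr_ge0// exprn_ge0.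
    exact: (uc k.+1).
  by rewrite mulrAC.
have umax k (t : R) : u k t = u k (Num.max t 0).
  case: k => [//|k]; apply/rowP => i; rewrite /u/= !mxE.
  by congr (_ + primitive _ _); rewrite -maxA maxxx.
have max0 (t : R) : 0 <= Num.max t 0 by rewrite le_max lexx orbT.
(* The error at time [t] is a geometric sequence with a ratio independent of [t]. *)
have /boolp.choice[x xu] : forall t : R, exists l : V, forall k,
    `|l - u k t| <= 2 * (c * expR (2 * K * Num.max t 0)) * 2^-1 ^+ k.
  move=> t; apply: (@geometric_cauchy_cvg R 1 n (u^~ t)) => k.
  by rewrite !(umax _ t); exact: step.
have geo (d e : R) : 0 <= d -> 0 < e -> exists k, d * 2^-1 ^+ k < e.
  move=> d0 e0.
  have q1 : `|2^-1 : R| < 1 by rewrite ger0_norm ?invr_ge0// invf_lt1// ltr1n.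
  have := @cvg_geometric R d 2^-1 q1.
  move=> /cvgrPdist_lt/(_ _ e0)[k _ /(_ k (leqnn k))/=].
  rewrite sub0r normrN => H; exists k; apply: le_lt_trans H; exact: ler_norm.
have xc : continuous x.
  move=> t; apply/cvgrPdist_le => e e0.
  pose M := 2 * (c * expR (2 * K * (Num.max t 0 + 1))).
  have M0 : 0 <= M by rewrite mulr_ge0// mulr_ge0// expR_ge0.
  have [k ke] : exists k, M * 2^-1 ^+ k < e / 3 by apply: geo => //; rewrite divr_gt0.
  have bnd (s : R) : Num.max s 0 <= Num.max t 0 + 1 -> `|x s - u k s| <= e / 3.
    move=> st; apply: le_trans (xu s k) _; apply: le_trans (ltW ke).
    rewrite ler_wpM2r ?exprn_ge0// ler_wpM2l// ler_wpM2l// ler_expR.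
    by rewrite ler_wpM2l// mulr_ge0// ltW.
  near=> s.
  have ut : `|u k t - u k s| <= e / 3.
    by near: s; move: (uc k t) => /cvgrPdist_le; apply; rewrite divr_gt0.
  have st : Num.max s 0 <= Num.max t 0 + 1.
    rewrite ge_max addr_ge0// andbT.
    apply: (@le_trans _ _ (t + 1)); last by rewrite lerD2r le_max lexx.
    by apply/ltW; near: s; apply: lt_nbhsl; rewrite ltrDl.
  have tt : Num.max t 0 <= Num.max t 0 + 1 by rewrite lerDl.
  have := bnd _ st; have := bnd _ tt; rewrite (distrC (x s)) => b1 b2.
  apply: (le_trans (ler_distD (u k t) _ _)).
  have := ler_distD (u k s) (u k t) (x s); lra.
have fix_x (t : R) : 0 <= t -> picard_map x t = x t.
  move=> t0; apply/eqP; rewrite -subr_eq0 -normr_le0; apply/ler_addgt0Pr => e e0.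
  rewrite add0r.
  pose M := c * expR (2 * K * t).
  have M0 : 0 <= M by rewrite mulr_ge0// expR_ge0.
  have [k ke] : exists k, (3 * M) * 2^-1 ^+ k < e by apply: geo => //; rewrite mulr_ge0.
  have H1 : `|picard_map x t - u k.+1 t| <= 2^-1 * (2 * c * 2^-1 ^+ k) * expR (2 * K * t).
    apply: picard_map_contract => //; first by rewrite mulr_ge0 ?exprn_ge0// mulr_ge0.
    by move=> s s0; have := xu s k; rewrite max_l// !mulrA (mulrAC _ (expR _)).
  have H2 : `|x t - u k.+1 t| <= 2 * M * 2^-1 ^+ k.+1.
    by have := xu t k.+1; rewrite max_l.
  apply: le_trans (ltW ke).
  apply: le_trans (ler_distD (u k.+1 t) _ _) _; rewrite (distrC _ (x t)).
  apply: le_trans (lerD H1 H2) _.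
  rewrite exprS /M; set E := expR _; set q := _ ^+ k.
  have cE : 0 <= c * E * q by apply: mulr_ge0; [rewrite mulr_ge0 ?expR_ge0|rewrite exprn_ge0].
  by lra.
exists x; split => //; first by rewrite -fix_x// picard_map0.
move=> t t0; apply: (@near_eq_is_derive _ _ _ (picard_map x)).
  by near=> s; apply: fix_x; apply/ltW; near: s; exact: lt_nbhsr.
exact: is_derive_picard_map.
Unshelve. all: by end_near. Qed.

End Picard.

(** * Systems of link forces and the decrease of their energy *)

Lemma continuous_sum_fct (R : realType) (T : topologicalType) (I : Type)
    (s : seq I) (P : pred I) (f : I -> T -> R) :
  (forall i, P i -> continuous (f i)) ->
  continuous (fun x => \sum_(i <- s | P i) f i x).
Proof. by apply: continuous_big; exact: add_continuous. Qed.

Lemma is_derive_sum_fct (R : realType) (V : normedModType R) (I : Type)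
    (s : seq I) (P : pred I) (f : I -> V -> R) (df : I -> R) (x v : V) :
  (forall i, P i -> is_derive x v (f i) (df i)) ->
  is_derive x v (fun y => \sum_(i <- s | P i) f i y) (\sum_(i <- s | P i) df i).
Proof.
move=> fd; elim: s => [|a s IH].
  rewrite big_nil; under eq_fun do rewrite big_nil.
  exact: is_derive_cst.
rewrite big_cons; under eq_fun do rewrite big_cons.
by case: ifPn => // Pa; exact: is_deriveD (fd a Pa) IH.
Qed.

Lemma within_continuous_post (T S U : topologicalType) (A : set T)
    (f : T -> S) (g : S -> U) :
  {within A, continuous f} -> continuous g -> {within A, continuous (g \o f)}.
Proof. by move=> fc gc x; exact: (cvg_comp _ _ (fc x) (gc (f x))). Qed.

Section GradientSystems.
Variables (R : realType) (N : nat) (e : rel 'I_N).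
Notation V := 'rV[R]_N.
Hypothesis sg : simple_graph e.
Implicit Types (x y : V) (h phi : R -> R).

(** The vector field and the potential of the system are of this form for
    [edge_force] and [edge_energy]; the truncated functions give another
    instance. *)
Definition link_field h x : V :=
  \row_i \sum_(j < N | e j i) h (x 0 i - x 0 j).

Definition link_energy phi x : R :=
  \sum_(p in links e) phi (x 0 p.1 - x 0 p.2).

Lemma link_fieldP h (u : V) x : (forall d, h (- d) = - h d) ->
  \sum_i u 0 i * link_field h x 0 i =
  \sum_(p in links e) (u 0 p.1 - u 0 p.2) * h (x 0 p.1 - x 0 p.2).
Proof.
move=> hN; under eq_bigr do rewrite mxE.
by apply: (sum_links_by_parts sg u (a := fun i j => h (x 0 i - x 0 j))) => i j;
  rewrite /= -hN opprB.
Qed.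

Lemma link_field_lipschitz h (k : R) : 0 <= k ->
  (forall a b, `|h a - h b| <= k * `|a - b|) ->
  forall x y, `|link_field h x - link_field h y| <= N%:R * (2 * k) * `|x - y|.
Proof.
move=> k0 hk x y.
apply: mx_norm_le => [|o i]; first by rewrite !mulr_ge0.
rewrite ord1 !mxE -sumrB.
apply: le_trans (ler_norm_sum _ _ _) _.
apply: (@le_trans _ _ (\sum_(j < N) 2 * k * `|x - y|)); last first.
  by rewrite sumr_const card_ord -[leLHS]mulr_natl mulrA.
rewrite big_mkcond/=; apply: ler_sum => j _.
have B0 : 0 <= 2 * k * `|x - y| by rewrite !mulr_ge0.
case: ifP => // _; apply: le_trans (hk _ _) _.
rewrite (mulrC 2) -mulrA ler_wpM2l//.
have -> : x 0 i - x 0 j - (y 0 i - y 0 j) = (x - y) 0 i - (x - y) 0 j.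
  by rewrite !mxE; ring.
apply: le_trans (ler_normB _ _) _.
have := mx_norm_ge_coord (x - y) 0 i; have := mx_norm_ge_coord (x - y) 0 j; lra.
Qed.

Lemma is_derive_coordB (x : R -> V) (t : R) dx i j :
  is_derive t 1 x dx ->
  is_derive t 1 (fun s => x s 0 i - x s 0 j) (dx 0 i - dx 0 j).
Proof. by move=> /is_derive_mxP xd; exact: is_deriveB (xd 0 i) (xd 0 j). Qed.

Lemma continuous_coordB i j : continuous (fun x => x 0 i - x 0 j : R).
Proof.
move=> x; apply: (@continuousB R R V (fun y : V => y 0 i) (fun y : V => y 0 j));
  exact: coord_continuous.
Qed.

(** The field is minus the gradient of the energy, so the derivative of the
    energy is minus the squared norm of the field, by [link_fieldP]. *)
Lemma link_energy_nonincreasing h phi (x : R -> V) :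
  (forall d, h (- d) = - h d) ->
  (forall d : R, is_derive d 1 phi (- h d)) ->
  {within `[0, +oo[, continuous x} ->
  (forall t : R, 0 < t -> is_derive t 1 x (link_field h (x t))) ->
  forall s t : R, 0 <= s -> s <= t ->
    link_energy phi (x t) <= link_energy phi (x s).
Proof.
move=> hN phid xc xd.
pose d (p : 'I_N * 'I_N) (y : V) := y 0 p.1 - y 0 p.2.
have Ec : continuous (link_energy phi).
  apply: continuous_sum_fct => p _ y.
  apply: (@continuous_comp _ _ _ (d p) phi); first exact: continuous_coordB.
  apply/differentiable_continuous/derivable1_diffP.
  by have [] := phid (d p y).
apply: (@nonincreasing_of_derive R _ (fun t : R => \sum_(p in links e)
   (- h (d p (x t))) * d p (link_field h (x t)))).
- exact: within_continuous_post xc Ec.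
- move=> t t0; apply: is_derive_sum_fct => p _.
  exact: (@is_derive1_comp R phi (fun s => d p (x s)) t _ _ (phid (d p (x t)))
    (is_derive_coordB p.1 p.2 (xd t t0))).
- move=> t t0.
  under eq_bigr do rewrite mulNr mulrC.
  rewrite sumrN -(link_fieldP (link_field h (x t)))// oppr_le0.
  by apply: sumr_ge0 => i _; rewrite -expr2 sqr_ge0.
Qed.

Lemma link_field_sum h x : (forall d, h (- d) = - h d) ->
  \sum_i link_field h x 0 i = 0.
Proof.
move=> hN; have := link_fieldP (const_mx 1) x hN.
under eq_bigr do rewrite mxE mul1r.
by move=> ->; rewrite big1// => p _; rewrite !mxE subrr mul0r.
Qed.

Lemma forall_links (P : R -> Prop) x :
  (forall d, P d -> P (- d)) ->
  (forall p, p \in links e -> P (x 0 p.1 - x 0 p.2)) ->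
  forall i j, e i j -> P (x 0 i - x 0 j).
Proof.
move=> PN Pl i j eij; have [esym eirr] := sg.
have [ij|ji|/val_inj ij] := ltngtP i j; last by rewrite ij eirr in eij.
  by apply: (Pl (i, j)); rewrite inE/= ij.
rewrite -opprB; apply: PN.
by apply: (Pl (j, i)); rewrite inE/= ji esym.
Qed.

Section Potential.
Variable r : R.

Lemma vector_fieldE x : vector_field e r x = link_field (edge_force r) x.
Proof. by []. Qed.

Lemma potentialE x : potential e r x = link_energy (edge_energy r) x.
Proof. by rewrite /potential mulr_sumr. Qed.

(** The other [L - 1] links carry at least [- r^2 / 4] each, which is what the
    critical potential subtracts. *)
Lemma edge_le_energy_gap phi x p : p \in links e ->
  (forall d, - (r ^+ 2) / 4 <= phi d) ->
  phi (x 0 p.1 - x 0 p.2) <= link_energy phi x - critical_potential e r.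
Proof.
move=> pl phi_ge; rewrite /link_energy /critical_potential.
have : \sum_(p' in links e) (- (r ^+ 2) / 4) = #|links e|%:R * (- (r ^+ 2) / 4).
  by rewrite sumr_const mulr_natl.
rewrite (bigD1 p)//= [in X in _ -> X](bigD1 p)//=.
have : \sum_(p' in links e | p' != p) (- (r ^+ 2) / 4) <=
    \sum_(p' in links e | p' != p) phi (x 0 p'.1 - x 0 p'.2) by apply: ler_sum.
by move=> H1 H2; lra.
Qed.

End Potential.
End GradientSystems.

(** * Solutions issued from subcritical states *)

Section Dynamics.
Variables (R : realType) (N : nat) (e : rel 'I_N) (r : R).
Notation V := 'rV[R]_N.
Hypothesis sg : simple_graph e.
Implicit Types (x y : V).

Lemma edge_energy_le_gap x i j : e i j ->
  edge_energy r (x 0 i - x 0 j) <= potential e r x - critical_potential e r.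
Proof.
apply: (forall_links sg (P := fun d => edge_energy r d <= _)).
  by move=> d; rewrite /edge_energy sqrrN.
move=> p pl; rewrite potentialE; apply: edge_le_energy_gap => // d.
exact: edge_energy_ge.
Qed.

(** Negative energy needs [d^2 < 2 r] and excludes [d = 0]. *)
Lemma edge_energy_lt0 d : edge_energy r d < 0 -> 0 < r /\ d != 0.
Proof.
rewrite /edge_energy pmulr_rlt0 ?invr_gt0// => fd; split.
  rewrite ltNge; apply/negP => r0; move: fd; rewrite ltNge => /negP; apply.
  rewrite mulr_ge0 ?sqr_ge0//.
  by have := sqr_ge0 d; lra.
by apply: contraTneq fd => ->; rewrite expr0n/= mul0r ltxx.
Qed.

Lemma subcritical_coupling_gt0 x i j : potential e r x < critical_potential e r ->
  e i j -> 0 < r.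
Proof.
move=> xV eij; have := edge_energy_le_gap x eij.
by move=> fe; have [] := @edge_energy_lt0 (x 0 i - x 0 j); first lra.
Qed.

(** The solution of the truncated system has truncated energy below critical at
    all times, since that energy is at most the potential initially and
    decreases.  Each link then has negative truncated energy, hence lies where
    the truncated force is the original one. *)
Lemma subcritical_solution_exists (x0 : V) :
  potential e r x0 < critical_potential e r ->
  exists x : R -> V, solution e r x /\ x 0 = x0.
Proof.
move=> xV; pose h := trunc_force r.
have hN d : h (- d) = - h d by exact: trunc_forceN.
have k0 : 0 <= 7 * `|r| by rewrite mulr_ge0.
(* The [+ 1] keeps the constant positive when [r = 0]. *)
pose K := N%:R * (2 * (7 * `|r|)) + 1.
have K0 : 0 < K by rewrite ltr_wpDl// !mulr_ge0.
have FK x y : `|link_field e h x - link_field e h y| <= K * `|x - y|.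
  have lip := @link_field_lipschitz R N e h _ k0 (trunc_force_lipschitz r) x y.
  by apply: le_trans lip _; rewrite ler_wpM2r// lerDl.
have [x [x00 xc xd]] := lipschitz_global_solution K0 FK x0.
exists x; split => //; split; first exact: continuous_subspaceT.
move=> t t0; suff <- : link_field e h (x t) = vector_field e r (x t) by exact: xd.
have xcw : {within `[0, +oo[, continuous x} by exact: continuous_subspaceT.
have dec := link_energy_nonincreasing sg hN (@is_derive_trunc_energy R r) xcw xd
  (lexx 0) (ltW t0).
have sub0 : link_energy e (trunc_energy r) x0 < critical_potential e r.
  apply: le_lt_trans xV; rewrite potentialE.
  by apply: ler_sum => p _; exact: trunc_energy_le.
apply/rowP => i; rewrite !mxE; apply: eq_bigr => j; have [esym _] := sg.
rewrite esym => eij; have r0 := subcritical_coupling_gt0 xV eij.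
apply: trunc_forceE.
apply: (forall_links sg (P := fun d => d ^+ 2 <= 2 * r)) eij.
  by move=> d; rewrite sqrrN.
move=> p pl; apply: trunc_energy_lt0; first exact: ltW.
have := edge_le_energy_gap (x t) pl (fun d => trunc_energy_ge d (ltW r0)).
by rewrite -x00 in sub0; lra.
Qed.

Lemma potential_nonincreasing (x : R -> V) (t : R) : solution e r x -> 0 <= t ->
  potential e r (x t) <= potential e r (x 0).
Proof.
move=> [xc xd] t0; rewrite !potentialE.
exact: (link_energy_nonincreasing sg (@edge_forceN R r)
  (@is_derive_edge_energy R r) xc xd (lexx 0) t0).
Qed.

(** A link difference is continuous and never [0] below the critical potential, so
    the intermediate value theorem forbids a change of sign. *)
Lemma solution_preserves_signs (x : R -> V) (t : R) i j : solution e r x ->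
  potential e r (x 0) < critical_potential e r -> 0 <= t -> e i j ->
  0 < (x t 0 i - x t 0 j) * (x 0 0 i - x 0 0 j).
Proof.
move=> sx xV t0 eij; pose d (s : R) : R := x s 0 i - x s 0 j.
have d0 s : 0 <= s -> d s != 0.
  move=> s0; have xsV := le_lt_trans (potential_nonincreasing sx s0) xV.
  have := edge_energy_le_gap (x s) eij.
  by move=> fe; have [] := @edge_energy_lt0 (d s); first (rewrite /d; lra).
have dc : {within `[0, t], continuous d}.
  have dcy : {within `[0, +oo[, continuous d}.
    exact: (within_continuous_post sx.1 (@continuous_coordB R N i j)).
  apply: continuous_subspaceW dcy => s /=.
  by rewrite !in_itv/= => /andP[->].
rewrite -/(d t) -/(d 0) ltNge; apply/negP => neg.
have [] := @IVT R d 0 t 0 t0 dc.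
  have := d0 0 (lexx 0); have := d0 t t0; move: neg.
  rewrite ge_min le_max; have [d1|d1|_] := ltrgtP (d 0) 0; last by [].
    have [d2|d2|_] := ltrgtP (d t) 0; rewrite ?orbT//.
    by rewrite leNgt nmulr_rgt0 ?d2// => /negP[].
  have [d2|d2|_] := ltrgtP (d t) 0; rewrite ?orbT//.
  by rewrite leNgt mulr_gt0.
by move=> s; rewrite in_itv/= => /andP[s0 _] ds; have := d0 s s0; rewrite ds eqxx.
Qed.

(** The forces at both ends of a link are opposite. *)
Lemma sum_solution_constant (x : R -> V) (t : R) : solution e r x -> 0 <= t ->
  \sum_i x t 0 i = \sum_i x 0 0 i.
Proof.
move=> [xc xd] t0.
have S0 s : \sum_i vector_field e r (x s) 0 i = 0.
  by rewrite vector_fieldE (link_field_sum sg)//; exact: edge_forceN.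
have Sc : {within `[0, +oo[, continuous (fun s => \sum_i x s 0 i)}.
  apply: (within_continuous_post (g := fun v : V => \sum_i v 0 i) xc).
  by apply: continuous_sum_fct => i _; exact: coord_continuous.
have Sd (s : R) : 0 < s -> is_derive s 1 (fun s => \sum_i x s 0 i) 0.
  move=> s0; have := @is_derive_sum_fct R R _ (index_enum _) predT
    (fun i s => x s 0 i) (fun i => vector_field e r (x s) 0 i) s 1
    (fun i _ => (is_derive_mxP _ _ _ _).1 (xd s s0) 0 i).
  by rewrite S0.
apply/eqP; rewrite eq_le; apply/andP; split.
  exact: (nonincreasing_of_derive Sc Sd).
rewrite -lerN2.
apply: (@nonincreasing_of_derive R (fun s => - \sum_i x s 0 i) (fun=> 0)) => //.
  by move=> s; apply: cvgN; exact: Sc.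
by move=> s s0; have := is_deriveN (Sd s s0); rewrite oppr0.
Qed.

End Dynamics.

(** * Exponential convergence inside a sign class *)

Section Convergence.
Variables (R : realType) (N : nat) (e : rel 'I_N) (r : R).
Notation V := 'rV[R]_N.
Hypothesis sg : simple_graph e.
Hypothesis econ : forall i j, connect e i j.

(** With [d'^2 = r], the force factors as [- d (d - d') (d + d')], and
    [d (d + d') >= d^2] when the signs agree. *)
Lemma edge_force_contracts (d d' k : R) : d' ^+ 2 = r -> 0 < d * d' -> k <= d ^+ 2 ->
  (d - d') * edge_force r d <= - k * (d - d') ^+ 2.
Proof.
move=> d'r dd' kd; rewrite /edge_force -d'r -subr_ge0.
have -> : - k * (d - d') ^+ 2 - (d - d') * (d' ^+ 2 * d - d ^+ 3) =
    (d ^+ 2 - k + d * d') * (d - d') ^+ 2 by ring.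
by rewrite mulr_ge0 ?sqr_ge0// addr_ge0 ?(ltW dd')// subr_ge0.
Qed.

(** Since [d^2 (d^2 - 2 r) <= - 4 g], one has [2 r d^2 >= 4 g]; the denominator
    [2 |r| + 1] avoids a discussion of the sign of [r]. *)
Lemma energy_gap_separates (d g : R) : 0 < g -> edge_energy r d <= - g ->
  4 * g / (2 * `|r| + 1) <= d ^+ 2.
Proof.
move=> g0 fd; have r1 : 0 < 2 * `|r| + 1 by rewrite ltr_wpDl// mulr_ge0.
rewrite ler_pdivrMr//.
have := sqr_ge0 d; have := sqr_ge0 (d ^+ 2); have := ler_norm r.
move=> rr d4 d2; have := ler_wpM2l d2 rr; move: fd; rewrite /edge_energy; lra.
Qed.

(** The product [E t * exp (a t)] is nonincreasing. *)
Lemma exp_decay (E dE : R -> R) (a : R) :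
  {within `[0, +oo[, continuous E} ->
  (forall t : R, 0 < t -> is_derive t 1 E (dE t)) ->
  (forall t : R, 0 < t -> dE t <= - a * E t) ->
  forall t : R, 0 <= t -> E t <= E 0 * expR (- (a * t)).
Proof.
move=> Ec Ed dEa t t0.
have gd (s : R) := is_derive_exp_scale 1 a s.
have gc : {within `[0, +oo[, continuous (fun s : R => 1 * expR (a * s))}.
  apply: continuous_subspaceT => s; apply/differentiable_continuous.
  by apply/derivable1_diffP; have [] := gd s.
have H := @nonincreasing_of_derive R (E * (fun s : R => 1 * expR (a * s))) _
  (fun s => continuousM (Ec s) (gc s)) (fun s s0 => is_deriveM (Ed s s0) (gd s)).
have {H} : E t * (1 * expR (a * t)) <= E 0 * (1 * expR (a * 0)).
  apply: (H _ 0 t (lexx 0) t0) => s s0; rewrite /GRing.scale/= mul1r.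
  have := ler_wpM2l (expR_ge0 (a * s)) (dEa s s0); lra.
by rewrite mulr0 expR0 !mul1r mulr1 expRN ler_pdivlMr// expR_gt0.
Qed.

(** A translate [q'] of [q] with the same mean as the solution is its limit; the
    mean of the difference stays [0], so the Poincare inequality applies to
    it at all times. *)
Lemma solution_converges (x : R -> V) (q : V) : (0 < N)%N -> solution e r x ->
  potential e r (x 0) < critical_potential e r ->
  (forall i j, e i j -> (q 0 i - q 0 j) ^+ 2 = r) ->
  (forall i j, e i j -> 0 < (x 0 0 i - x 0 0 j) * (q 0 i - q 0 j)) ->
  state_of (x t) @[t --> +oo] --> state_of q.
Proof.
move=> N0 sx xV qr xq; have [xc xd] := sx.
(* The translation making the initial difference have mean zero. *)
pose m := (\sum_i (x 0 0 i - q 0 i)) / N%:R.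
pose q' := q + const_mx m.
have q'E i j : q' 0 i - q' 0 j = q 0 i - q 0 j by rewrite !mxE; ring.
have -> : state_of q = state_of q'.
  by apply/eqmodP/asboolP; exists m.
pose z t : V := x t - q'.
have zE t i j : z t 0 i - z t 0 j = (x t 0 i - x t 0 j) - (q 0 i - q 0 j).
  by rewrite -q'E !mxE; ring.
have z_mean (t : R) : 0 <= t -> \sum_i z t 0 i = 0.
  move=> t0; under eq_bigr do rewrite !mxE.
  rewrite sumrB big_split/= (sum_solution_constant sg sx t0) sumr_const card_ord.
  rewrite -mulr_natr /m divfK ?pnatr_eq0 -?lt0n//.
  by rewrite sumrB; ring.
pose g := critical_potential e r - potential e r (x 0).
have g0 : 0 < g by rewrite subr_gt0.
(* A lower bound for the squared link differences along the solution. *)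
pose k := 4 * g / (2 * `|r| + 1).
have k0 : 0 < k by rewrite divr_gt0 ?mulr_gt0// ltr_wpDl// mulr_ge0.
have [C C0 HC] := @poincare R N e sg econ.
pose a := 2 * k / C.
have a0 : 0 < a by rewrite divr_gt0// mulr_gt0.
pose E t := \sum_i z t 0 i ^+ 2.
have zd (t : R) i : 0 < t ->
    is_derive t 1 (fun s => z s 0 i) (vector_field e r (x t) 0 i).
  move=> t0; have D1 := (is_derive_mxP _ _ _ _).1 (xd t t0) 0 i.
  have := is_deriveB D1 (is_derive_cst (q' 0 i) t 1); rewrite subr0.
  by congr (is_derive _ _ _ _); apply/funext => s; rewrite !mxE.
have Ed (t : R) : 0 < t ->
    is_derive t 1 E (\sum_i 2 * z t 0 i * vector_field e r (x t) 0 i).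
  move=> t0; apply: is_derive_sum_fct => i _.
  have := is_deriveX 2 (zd t i t0); rewrite /GRing.scale/= expr1.
  exact.
have Ec : {within `[0, +oo[, continuous E}.
  have -> : E = (fun v : V => \sum_i (v 0 i - q' 0 i) ^+ 2) \o x.
    by apply/funext => t; apply: eq_bigr => i _; rewrite !mxE.
  apply: (within_continuous_post xc).
  apply: continuous_sum_fct => i _ y.
  apply: (@continuous_comp V R R (fun v : V => v 0 i) (fun d => (d - q' 0 i) ^+ 2)).
    exact: coord_continuous.
  apply: (@continuous_comp R R R (fun d => d - q' 0 i) (fun d : R => d ^+ 2)).
    by apply: cvgB; [exact: cvg_id|exact: cvg_cst].
  exact: exprn_continuous.
have Ele (t : R) : 0 < t ->
    \sum_i 2 * z t 0 i * vector_field e r (x t) 0 i <= - a * E t.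
  move=> t0; under eq_bigr do rewrite -mulrA.
  rewrite -mulr_sumr vector_fieldE (link_fieldP sg)//; last exact: edge_forceN.
  set Q := \sum_(p in links e) (z t 0 p.1 - z t 0 p.2) ^+ 2.
  apply: (@le_trans _ _ (2 * (- k * Q))); last first.
    have := HC _ (z_mean t (ltW t0)); rewrite -/(E t) -/Q => EC.
    have := ler_wpM2l (ltW a0) EC.
    have -> : a * (C * Q) = 2 * k * Q by rewrite mulrA /a divfK ?gt_eqF.
    by lra.
  rewrite ler_pM2l// /Q mulr_sumr; apply: ler_sum => -[i j]; rewrite inE/= => /andP[_ eij].
  rewrite zE; apply: edge_force_contracts; first exact: qr.
    have := solution_preserves_signs sg sx xV (ltW t0) eij.
    move=> s1; have s2 := xq i j eij.
    have := mulr_gt0 s1 s2; rewrite mulrACA [X in 0 < X](_ : _ =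
     (x 0 0 i - x 0 0 j) ^+ 2 * ((x t 0 i - x t 0 j) * (q 0 i - q 0 j))); last by ring.
    rewrite pmulr_rgt0// exprn_even_gt0//=.
    by apply: contraTneq s2 => ->; rewrite mul0r ltxx.
  apply: energy_gap_separates => //.
  have xtV := potential_nonincreasing sg sx (ltW t0).
  have := edge_energy_le_gap r sg (x t) eij.
  by rewrite /g; lra.
have Edec := exp_decay Ec Ed Ele.
have E0 : E t @[t --> +oo] --> 0.
  have b0 : E 0 * expR (- (a * t)) @[t --> +oo] --> 0.
    rewrite -[X in _ --> X](mulr0 (E 0)); apply: cvgM; first exact: cvg_cst.
    apply: (@cvg_comp _ _ _ (fun t => a * t) (fun u => expR (- u)) _ (pinfty_nbhs R)).
      exact: gt0_cvgMry.
    exact: cvgr_expR.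
  apply: (squeeze_cvgr _ (cvg_cst 0) b0).
  near=> t; apply/andP; split; first by apply: sumr_ge0 => i _; exact: sqr_ge0.
  by apply: Edec; near: t; exact: nbhs_pinfty_ge.
suff xq' : x t @[t --> +oo] --> q'.
  exact: (cvg_comp _ _ xq' (@pi_continuous _ _ q')).
apply: cvg_mx_coord => o i; rewrite ord1 {o}.
apply/cvgrPdist_lt => eps eps0.
have e2 : 0 < eps ^+ 2 by rewrite exprn_gt0.
have := E0 => /cvgrPdist_lt/(_ _ e2); apply: filterS => t.
rewrite sub0r normrN => Et.
rewrite -ltr_sqr ?nnegrE ?(ltW eps0)// real_normK ?num_real//.
apply: le_lt_trans Et; apply: le_trans (ler_norm _).
rewrite /E (bigD1 i)//= !mxE -sqrrN opprB lerDl.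
by apply: sumr_ge0 => j _; exact: sqr_ge0.
Unshelve. all: by end_near. Qed.

End Convergence.

(** * Linear stability of stationary states *)

Section StateSpaceFacts.
Variables (R : realType) (N : nat).
Notation V := 'rV[R]_N.

Lemma state_of_repr (p : state_space R N) : state_of (repr p) = p.
Proof. exact: reprK. Qed.

Lemma state_diff_continuous i j :
  continuous (fun p : state_space R N => repr p 0 i - repr p 0 j : R).
Proof.
apply/quotient_continuous => x.
rewrite (_ : _ \o _ = fun x : V => x 0 i - x 0 j); first exact: continuous_coordB.
by apply/funext => y /=; exact: repr_state_of_diff.
Qed.

(** On a connected graph, link differences determine all differences. *)
Lemma eq_state (e : rel 'I_N) (p q : state_space R N) :
  (forall i j, connect e i j) ->
  (forall i j, e i j ->
     repr p 0 i - repr p 0 j = repr q 0 i - repr q 0 j) -> p = q.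
Proof.
move=> con pq; rewrite -(state_of_repr p) -(state_of_repr q).
have D i j : repr p 0 i - repr p 0 j = repr q 0 i - repr q 0 j.
  case/connectP: (con i j) => s; elim: s i => [|k s IH] i /=.
    by move=> _ ->; rewrite !subrr.
  case/andP => /pq ik ps jl; have := IH _ ps jl; lra.
apply/eqmodP/asboolP.
case: (pickP (xpredT : pred 'I_N)) => [k _|none]; last first.
  by exists 0; apply/rowP => i; have := none i.
exists (repr q 0 k - repr p 0 k); apply/rowP => i; rewrite !mxE.
by have := D i k; lra.
Qed.

End StateSpaceFacts.

Section Linearization.
Variables (R : realType) (N : nat) (e : rel 'I_N) (r : R).
Notation V := 'rV[R]_N.
Hypothesis sg : simple_graph e.

Lemma differentiable_sum_fct (W : normedModType R) (I : Type) (s : seq I)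
    (P : pred I) (f : I -> V -> W) (x : V) :
  (forall i, differentiable (f i) x) ->
  differentiable (fun y => \sum_(i <- s | P i) f i y) x.
Proof.
move=> fd; elim: s => [|a s IH].
  by under eq_fun do rewrite big_nil; exact: differentiable_cst.
under eq_fun do rewrite big_cons.
by case: (P a) => //; exact: differentiableD (fd a) IH.
Qed.

Lemma vector_field_differentiable (x : V) : differentiable (vector_field e r) x.
Proof.
have -> : vector_field e r = fun y => \sum_i
    (\sum_(j < N | e j i) (r * (y 0 i - y 0 j) - (y 0 i - y 0 j) ^+ 3)) *:
    (delta_mx 0 i : V).
  apply/funext => y; rewrite [LHS]row_sum_delta.
  by apply: eq_bigr => i _; rewrite mxE.
apply: differentiable_sum_fct => i; apply: differentiableZl.
apply: differentiable_sum_fct => j.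
have dd : differentiable (fun y : V => y 0 i - y 0 j) x.
  by apply: differentiableB; exact: differentiable_coord.
exact: differentiableB (differentiableZ r dd) (differentiableX 2 dd).
Qed.

Lemma is_derive_vector_field (x v : V) : is_derive x v (vector_field e r)
  (\row_i \sum_(j < N | e j i)
     (r - 3 * (x 0 i - x 0 j) ^+ 2) * (v 0 i - v 0 j)).
Proof.
apply/is_derive_mxP => o i; rewrite ord1 mxE {o}.
under eq_fun do rewrite mxE.
apply: is_derive_sum_fct => j _.
have D1 := (is_derive_mxP _ _ _ _).1 (is_derive_id x v) 0 i.
have D2 := (is_derive_mxP _ _ _ _).1 (is_derive_id x v) 0 j.
have D := is_deriveB D1 D2.
have := is_deriveB (is_deriveZ r D) (is_deriveX 3 D).
by move/is_derive_eq; apply; rewrite /GRing.scale/= !fctE; ring.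
Qed.

Lemma jacobian_form (x v : V) :
  (v *m jacobian (vector_field e r) x *m v^T) 0 0 =
  \sum_(p in links e)
     (r - 3 * (x 0 p.1 - x 0 p.2) ^+ 2) * (v 0 p.1 - v 0 p.2) ^+ 2.
Proof.
rewrite /jacobian mul_rV_lin1 -deriveE; last exact: vector_field_differentiable.
have [_ ->] := is_derive_vector_field x v.
rewrite mxE; under eq_bigr do rewrite !mxE mulrC.
rewrite (sum_links_by_parts sg v (a := fun i j =>
  (r - 3 * (x 0 i - x 0 j) ^+ 2) * (v 0 i - v 0 j))).
  by apply: eq_bigr => p _; ring.
by move=> i j; ring.
Qed.

End Linearization.

Section StableStates.
Variables (R : realType) (N : nat) (e : rel 'I_N) (r : R).
Hypothesis treee : tree e.

Let sg : simple_graph e.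
Proof. by case: treee. Qed.

(** Choosing as test vector a state whose link differences are the link forces
    turns stationarity into the vanishing of a sum of squares. *)
Lemma stationary_edge_force (q : state_space R N) i j : stationary e r q ->
  e i j -> edge_force r (repr q 0 i - repr q 0 j) = 0.
Proof.
move=> qs; apply: (forall_links sg (P := fun d => edge_force r d = 0)).
  by move=> d; rewrite edge_forceN => ->; rewrite oppr0.
have [|u us] := @tree_potential N e R
  (fun k l => edge_force r (repr q 0 k - repr q 0 l)) treee.
  by move=> k l; rewrite -edge_forceN opprB.
have : \sum_i u 0 i * link_field e (edge_force r) (repr q) 0 i = 0.
  rewrite -vector_fieldE; move: qs; rewrite /stationary => ->.
  by rewrite big1// => k _; rewrite mxE mulr0.
rewrite (link_fieldP sg)//; last exact: edge_forceN.
rewrite (eq_bigr (fun p => edge_force r (repr q 0 p.1 - repr q 0 p.2) ^+ 2)); last first.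
  by move=> p; rewrite inE => /andP[_ ep]; rewrite us// expr2.
move/eqP; rewrite psumr_eq0; last by move=> p _; exact: sqr_ge0.
move=> /allP H p pl; have := H p (mem_index_enum p).
by rewrite pl/= sqrf_eq0 => /eqP.
Qed.

(** The Jacobian form is evaluated at the vector, centred to mean zero, whose
    difference is [1] along one link and [0] along all others. *)
Lemma stable_edge_slope (q : state_space R N) i j : stable e r q -> e i j ->
  r - 3 * (repr q 0 i - repr q 0 j) ^+ 2 < 0.
Proof.
move=> [_ qn]; apply: (forall_links sg (P := fun d => r - 3 * d ^+ 2 < 0)).
  by move=> d; rewrite sqrrN.
have N0 : (0 < N)%N by case: treee.
move=> p0 pl.
(* The unit difference along the link [p0], antisymmetrised. *)
pose s k l : R := ((k, l) == p0)%:R - ((l, k) == p0)%:R.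
have [|u us] := @tree_potential N e R s treee.
  by move=> k l; rewrite /s opprB.
pose m := (\sum_i u 0 i) / N%:R.
pose v := u - const_mx m.
have vE k l : v 0 k - v 0 l = u 0 k - u 0 l by rewrite !mxE; ring.
have s1 : s p0.1 p0.2 = 1.
  move: pl; rewrite inE => /andP[lt _]; rewrite /s -surjective_pairing eqxx.
  case: eqP => [E|_]; last by rewrite subr0.
  by have /= E2 := congr1 fst E; rewrite E2 ltnn in lt.
have := qn v; rewrite (jacobian_form r sg) (bigD1 p0)//= big1 ?addr0.
  rewrite vE us; last by move: pl; rewrite inE => /andP[].
  rewrite s1 expr1n mulr1; apply.
    apply/eqP => v0; have := vE p0.1 p0.2; rewrite v0 us.
      by rewrite s1 !mxE subrr => /esym/eqP; rewrite oner_eq0.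
    by move: pl; rewrite inE => /andP[].
  apply/rowP => k; rewrite !mxE; under eq_bigr do rewrite !mxE mulr1.
  rewrite sumrB sumr_const card_ord -mulr_natr /m divfK ?subrr//.
  by rewrite pnatr_eq0 -lt0n.
move=> p /andP[pl' pp0]; rewrite vE us; last by move: pl'; rewrite inE => /andP[].
rewrite /s -surjective_pairing (negPf pp0).
case: eqP => [E|_]; last by rewrite subrr expr0n mulr0.
move: pl pl'; rewrite !inE -E/= => /andP[+ _] /andP[+ _].
by move=> /ltnW; rewrite leqNgt => /negP.
Qed.

(** The force vanishes only at [d = 0] or [d^2 = r], and at [d = 0] its slope is
    [r > 0]. *)
Lemma stable_edge_sqr (q : state_space R N) i j : stable e r q -> 0 < r -> e i j ->
  (repr q 0 i - repr q 0 j) ^+ 2 = r.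
Proof.
move=> qs r0 eij; have slope := stable_edge_slope qs eij.
have := stationary_edge_force qs.1 eij; rewrite /edge_force.
set d := repr q 0 i - repr q 0 j in slope *.
have -> : r * d - d ^+ 3 = d * (r - d ^+ 2) by ring.
move/eqP; rewrite mulf_eq0 => /orP[/eqP d0|]; last by rewrite subr_eq0 => /eqP.
by move: slope; rewrite d0 expr0n/= mulr0 subr0 => /(lt_trans r0); rewrite ltxx.
Qed.

(** All links have slope [- 2 r], so the Jacobian form is [- 2 r] times the
    sum of the squared link differences, which is positive by the Poincare
    inequality; the hypothesis [0 < r] is attached to the links, as a single node
    is a stable state for every [r]. *)
Lemma stable_of_edge_sqr (q : state_space R N) :
  (forall i j, e i j -> 0 < r /\ (repr q 0 i - repr q 0 j) ^+ 2 = r) ->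
  stable e r q.
Proof.
have [esym _] := sg.
have [_ _ con _] := treee.
move=> qr; split.
  rewrite /stationary; apply/rowP => i; rewrite !mxE big1// => j.
  rewrite esym => /qr[_]; set d := repr q 0 i - repr q 0 j => dr.
  by rewrite exprS dr mulrC subrr.
move=> v v0 v1; rewrite (jacobian_form r sg).
have vs : \sum_i v 0 i = 0.
  have /rowP/(_ 0) := v1; rewrite !mxE => H; rewrite -[RHS]H.
  by apply: eq_bigr => i _; rewrite !mxE mulr1.
have [C C0 /(_ v vs)] := @poincare R N e sg con.
set Q := \sum_(p in links e) _ => vQ.
have Q0 : 0 < Q.
  rewrite -(pmulr_rgt0 _ C0); apply: lt_le_trans vQ.
  rewrite lt_neqAle sumr_ge0 ?andbT; last by move=> *; exact: sqr_ge0.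
  apply: contra v0; rewrite eq_sym psumr_eq0; last by move=> *; exact: sqr_ge0.
  move=> /allP H; apply/eqP/rowP => i; rewrite mxE; apply/eqP.
  by rewrite -sqrf_eq0; exact: H (mem_index_enum i).
have r0 : 0 < r.
  have [E|[p]] := set_0Vmem (links e); first by rewrite /Q E big_set0 ltxx in Q0.
  by rewrite inE => /andP[_ /qr[]].
rewrite (eq_bigr (fun p => - (2 * r) * (v 0 p.1 - v 0 p.2) ^+ 2)).
  by rewrite -mulr_sumr -/Q pmulr_llt0// oppr_lt0 mulr_gt0.
by move=> p; rewrite inE => /andP[_ /qr[_ ->]]; ring.
Qed.

End StableStates.

(** * Basins of attraction below the critical potential *)

(** Signs are preserved at all times, so they pass to the limit in the weak sense;
    they are strict there because the link differences of a stable state do not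
    vanish. *)
Lemma basin_stable_same_signs (R : realType) (N : nat) (e : rel 'I_N) (r : R)
    (p q : state_space R N) (i j : 'I_N) : tree e -> stable e r q ->
  basin e r q p -> potential e r (repr p) < critical_potential e r -> e i j ->
  0 < (repr p 0 i - repr p 0 j) * (repr q 0 i - repr q 0 j).
Proof.
move=> treee qs [x [sx <- xq]]; rewrite potential_repr => xV eij.
have [_ sg _ _] := treee.
have r0 := subcritical_coupling_gt0 sg xV eij.
rewrite repr_state_of_diff.
have := solution_preserves_signs sg sx xV (lexx 0) eij => x00.
have q0 : repr q 0 i - repr q 0 j != 0.
  have := stable_edge_sqr treee qs r0 eij; apply: contra_eq_neq => ->.
  by rewrite expr0n/= lt_eqF.
rewrite lt_neqAle eq_sym mulf_neq0 ?q0 ?andbT//=; last first.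
  by apply: contraTneq x00 => ->; rewrite mul0r ltxx.
have dq : (x t 0 i - x t 0 j) @[t --> +oo] --> repr q 0 i - repr q 0 j.
  have := cvg_comp _ _ xq (@state_diff_continuous R N i j q).
  rewrite (_ : _ \o _ = fun t => x t 0 i - x t 0 j)//.
  by apply/funext => t /=; exact: repr_state_of_diff.
rewrite mulrC.
apply: (cvgr_to_ge (cvgM dq (cvg_cst (x 0 0 i - x 0 0 j)))).
near=> t; apply/ltW/(solution_preserves_signs sg sx xV) => //.
Unshelve. all: by end_near. Qed.

Lemma same_signs_basin (R : realType) (N : nat) (e : rel 'I_N) (r : R)
    (p q : state_space R N) : tree e -> stable e r q ->
  potential e r (repr p) < critical_potential e r ->
  (forall i j, e i j ->
    0 < (repr p 0 i - repr p 0 j) * (repr q 0 i - repr q 0 j)) ->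
  basin e r q p.
Proof.
move=> treee qs pV pq; have [N0 sg con _] := treee.
have [x [sx x0]] := subcritical_solution_exists sg pV.
exists x; split => //; first by rewrite x0 state_of_repr.
rewrite -(state_of_repr q).
apply: (solution_converges sg con N0 sx); rewrite ?x0//.
move=> i j eij; apply: (stable_edge_sqr treee qs _ eij).
by have := subcritical_coupling_gt0 sg pV eij.
Qed.

(** The tree carries a state whose link differences are [sqrt r] times the signs
    of those of [p]. *)
Lemma stable_with_signs_of (R : realType) (N : nat) (e : rel 'I_N) (r : R)
    (p : state_space R N) : tree e ->
  potential e r (repr p) < critical_potential e r ->
  exists2 q : state_space R N, stable e r q & forall i j, e i j ->
    0 < (repr p 0 i - repr p 0 j) * (repr q 0 i - repr q 0 j).
Proof.
move=> treee pV; have [_ sg _ _] := treee.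
pose d i j := repr p 0 i - repr p 0 j.
have dN i j : d j i = - d i j by rewrite /d opprB.
have d0 i j : e i j -> d i j != 0.
  move=> eij; have := edge_energy_le_gap r sg (repr p) eij => fe.
  by have [] := @edge_energy_lt0 R r (d i j); first by rewrite /d; lra.
have [|u us] := @tree_potential N e R (fun i j => Num.sqrt r * Num.sg (d i j)) treee.
  by move=> i j; rewrite dN sgrN mulrN.
exists (state_of u) => [|i j eij].
  apply: (stable_of_edge_sqr treee) => i j eij.
  have r0 := subcritical_coupling_gt0 sg pV eij; split => //.
  rewrite repr_state_of_diff us// exprMn sqr_sqrtr ?ltW//.
  by rewrite sqr_sg d0// mulr1.
have r0 := subcritical_coupling_gt0 sg pV eij.
rewrite repr_state_of_diff us// -/(d i j) mulrCA [d i j * _]mulrC.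
by rewrite -normrEsg mulr_gt0 ?sqrtr_gt0// normr_gt0 d0.
Qed.

Theorem proposition4 (R : realType) (N : nat) (e : rel 'I_N) (r : R)
    (treee : tree e) :
  [/\ subcritical e r =
        \bigcup_(q in stable e r) (basin e r q `&` subcritical e r),
      trivIset (stable e r) (fun q => basin e r q `&` subcritical e r) &
      forall q : state_space R N, stable e r q ->
        basin e r q `&` subcritical e r =
        [set p : state_space R N | (forall i j : 'I_N, e i j ->
                    0 < (repr p 0 i - repr p 0 j) * (repr q 0 i - repr q 0 j))
                 /\ potential e r (repr p) < critical_potential e r]].
Proof.
split.
- apply/seteqP; split=> [p pV|p [q _ []]//].
  have [q qs pq] := stable_with_signs_of treee pV.
  by exists q => //; split => //; exact: same_signs_basin pq.
- move=> q1 q2 q1s q2s [p [[b1 pV] [b2 _]]].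
  have [_ sg con _] := treee.
  apply: (eq_state con) => i j eij.
  have r0 := subcritical_coupling_gt0 sg pV eij.
  have s1 := basin_stable_same_signs treee q1s b1 pV eij.
  have s2 := basin_stable_same_signs treee q2s b2 pV eij.
  have e1 := stable_edge_sqr treee q1s r0 eij.
  have e2 := stable_edge_sqr treee q2s r0 eij.
  move: s1 s2 e1 e2; set a := repr p 0 i - _; set b := repr q1 0 i - _.
  set c := repr q2 0 i - _ => ab ac b2r c2r.
  have /eqP := etrans b2r (esym c2r); rewrite eqf_sqr => /orP[/eqP//|/eqP bc].
  by move: ab; rewrite bc mulrN oppr_gt0 => /(lt_trans ac); rewrite ltxx.
- move=> q qs; apply/seteqP; split=> p [H pV]; split=> //.
    by move=> i j eij; exact: (basin_stable_same_signs treee qs H pV eij).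
  exact: (same_signs_basin treee qs pV H).
Qed.
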